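(* Let $\mathbb{F}=\mathbb{R}$ or $\mathbb{C}$, $n\ge1$, $A\in\mathbb{F}^{n\times n}$, let $\mathcal{S}$ be a $p$-dimensional linear subspace of $\mathbb{F}^n$, and let $q=\mathrm{Ind}_A(\mathcal{S})$. Then: (i) $\mathrm{Ind}_A(\mathcal{S})\le\min\{\dim(\mathcal{S}),\,n-\dim(\mathcal{S})\}\le\lfloor n/2\rfloor$. (ii) If $p\ge1$, there exists a semi-unitary $V\in\mathbb{F}^{n\times p}$ with $\operatorname{Im}(V)=\mathcal{S}$; and when also $q\ge1$, there exists $V'\in\mathbb{F}^{n\times q}$ such that $\begin{bmatrix}V&V'\end{bmatrix}$ is semi-unitary, $\operatorname{Im}(\begin{bmatrix}V&V'\end{bmatrix})=\mathcal{S}+A\mathcal{S}$, and $\operatorname{Im}(V')=\mathcal{S}^\perp\cap(\mathcal{S}+A\mathcal{S})$.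
   Context: The index of invariance of a subspace $\mathcal{S}\subseteq\mathbb{F}^n$ with respect to $A\in\mathbb{F}^{n\times n}$ is $\mathrm{Ind}_A(\mathcal{S}):=\dim(\mathcal{S}+A\mathcal{S})-\dim(\mathcal{S})$, where $A\mathcal{S}=\{Ax:x\in\mathcal{S}\}$. A matrix is semi-unitary if its columns are orthonormal. $\operatorname{Im}$ denotes the column space and $\perp$ the orthogonal complement for the standard inner product. *)

(* Defs.v *)
From HB Require Import structures.
From mathcomp Require Import all_boot all_order all_algebra.
From mathcomp Require Export complex reals.
Set Implicit Arguments.
Unset Strict Implicit.
Unset Printing Implicit Defensive.
Import Order.TTheory GRing.Theory Num.Theory.
Local Open Scope ring_scope.

Variant RorC := RealScalars | ComplexScalars.

Definition RCfield (R : realType) (K : RorC) : numFieldType :=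
  match K with RealScalars => R | ComplexScalars => R[i] end.

Definition RCconj (R : realType) (K : RorC) : RCfield R K -> RCfield R K :=
  match K with RealScalars => idfun | ComplexScalars => Num.conj end.

Lemma RCconj_zmod_morphism (R : realType) (K : RorC) :
  zmod_morphism (@RCconj R K).
Proof. by case: K => x y //=; rewrite rmorphB. Qed.

Lemma RCconj_monoid_morphism (R : realType) (K : RorC) :
  monoid_morphism (@RCconj R K).
Proof. by case: K => //=; split=> [|x y]; rewrite ?rmorph1 ?rmorphM. Qed.

HB.instance Definition _ (R : realType) (K : RorC) :=
  GRing.isZmodMorphism.Build (RCfield R K) (RCfield R K) (@RCconj R K)
    (@RCconj_zmod_morphism R K).
HB.instance Definition _ (R : realType) (K : RorC) :=
  GRing.isMonoidMorphism.Build (RCfield R K) (RCfield R K) (@RCconj R K)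
    (@RCconj_monoid_morphism R K).

Lemma RCconjK (R : realType) (K : RorC) : involutive (@RCconj R K).
Proof. by case: K => //= x; apply: Num.Theory.conjCK. Qed.

Lemma mul_RCconj_ge0 (R : realType) (K : RorC) (x : RCfield R K) :
  0 <= x * RCconj x.
Proof.
by case: K x => x /=; [rewrite -expr2 sqr_ge0 | apply: mul_conjC_ge0].
Qed.

(* The standard inner product, linear in its first argument; the choice of
   the conjugated argument affects neither orthogonality nor norms. *)
Definition dot (R : realType) (K : RorC) (n : nat) (x y : 'cV[RCfield R K]_n) :
  RCfield R K := \sum_(i < n) x i 0 * RCconj (y i 0).

Section DotInstances.
Context (R : realType) (K : RorC) (n : nat).
Implicit Types x y : 'cV[RCfield R K]_n.

Lemma dot_bilinear : bilinear_for *%R (@RCconj R K \; *%R) (@dot R K n).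
Proof.
split=> z a x y; rewrite /dot /= mulr_sumr -big_split; apply: eq_bigr => i _.
  by rewrite !mxE mulrDl mulrA.
by rewrite !mxE rmorphD rmorphM mulrDr mulrCA.
Qed.

HB.instance Definition _ :=
  bilinear_isBilinear.Build (RCfield R K) 'cV[RCfield R K]_n 'cV[RCfield R K]_n
    (RCfield R K) *%R (@RCconj R K \; *%R) (@dot R K n) dot_bilinear.

Lemma dot_hermitian x y : dot x y = (-1) ^+ false * RCconj (dot y x).
Proof.
rewrite expr0 mul1r /dot rmorph_sum; apply: eq_bigr => i _.
by rewrite rmorphM /= (RCconjK (x i 0)) mulrC.
Qed.

HB.instance Definition _ :=
  isHermitianSesquilinear.Build (RCfield R K) 'cV[RCfield R K]_n false
    (@RCconj R K) (@dot R K n) dot_hermitian.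

Lemma dot_pos x : x != 0 -> 0 < dot x x.
Proof.
move=> x_neq0; rewrite lt0r sumr_ge0 => [|i _]; last exact: mul_RCconj_ge0.
rewrite andbT; apply: contra x_neq0 => /eqP d0.
apply/eqP/colP => i; rewrite mxE; apply/eqP.
have /(_ i isT) /eqP := psumr_eq0P (fun i _ => mul_RCconj_ge0 (x i 0)) d0.
by rewrite mulf_eq0 fmorph_eq0 orbb.
Qed.

HB.instance Definition _ :=
  isDotProduct.Build (RCfield R K) 'cV[RCfield R K]_n (@dot R K n) dot_pos.

End DotInstances.

Definition cols (F : fieldType) (m n : nat) (V : 'M[F]_(m, n)) :
  seq 'cV[F]_m := [seq col j V | j <- enum 'I_n].

Definition colspace (F : fieldType) (m n : nat) (V : 'M[F]_(m, n)) :
  {vspace 'cV[F]_m} := <<cols V>>%VS.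

Definition semi_unitary (R : realType) (K : RorC) (m n : nat)
    (V : 'M[RCfield R K]_(m, n)) : bool :=
  orthonormal (@dot R K m) (cols V).

Definition orthocompl (R : realType) (K : RorC) (n : nat)
    (S : {vspace 'cV[RCfield R K]_n}) : {vspace 'cV[RCfield R K]_n} :=
  orthov (@dot R K n) S.

Lemma mem_orthocompl (R : realType) (K : RorC) (n : nat)
    (S : {vspace 'cV[RCfield R K]_n}) (x : 'cV[RCfield R K]_n) :
  reflect (forall y, y \in S -> dot x y = 0) (x \in orthocompl S).
Proof. exact: mem_orthovP. Qed.

Definition mximg (F : fieldType) (m n : nat) (A : 'M[F]_(m, n))
    (S : {vspace 'cV[F]_n}) : {vspace 'cV[F]_m} :=
  (linfun (mulmx A : 'cV[F]_n -> 'cV[F]_m) @: S)%VS.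

(* The subtraction on nat never truncates, as S <= S + A S. *)
Definition invariance_index (F : fieldType) (n : nat) (A : 'M[F]_n)
    (S : {vspace 'cV[F]_n}) : nat := (\dim (S + mximg A S) - \dim S)%N.

(* Main.v *)
(* Intersecting a subspace T with the orthogonal of one vector lowers its
   dimension by at most one, so T meets the orthogonal of S in dimension at
   least dim T - dim S. As the inner product is anisotropic, S and its orthogonal
   are disjoint, whence T is the direct sum of S and of its orthogonal in T
   whenever S <= T. This splitting, applied to lines, gives orthonormal bases,
   and applied to S <= S + A S, it gives V' as an orthonormal basis of the
   orthogonal of S in S + A S. *)
Require Import Defs.
From mathcomp Require Import all_boot all_order all_algebra.
From mathcomp Require Import zify.
Set Implicit Arguments.
Unset Strict Implicit.
Unset Printing Implicit Defensive.
Import Order.TTheory GRing.Theory Num.Theory.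
Local Open Scope ring_scope.

Section HermitianForms.
Context (F : fieldType) (eps : bool) (theta : {rmorphism F -> F}).
Context (vT : vectType F) (form : {hermitian vT for eps & theta}).
Implicit Types (U V W : {vspace vT}) (s : seq vT).

Lemma orthov_addv V W : orthov form (V + W) = (orthov form V :&: orthov form W)%VS.
Proof.
apply: subv_anti; rewrite subv_cap -orthovD subvv orthovD.
by rewrite capvSl capvSr.
Qed.

Lemma leq_dim_cap_orthov_span U s :
  (\dim U <= \dim (U :&: orthov form <<s>>) + size s)%N.
Proof.
elim: s => [|u s IHs] /=; first by rewrite span_nil orthov0 capvf addn0.
(* The intersections are regrouped with the orthogonal of [u] outermost, so the one-vector bound
   applies to the space of the induction hypothesis. *)
rewrite span_cons orthov_addv [in X in (_ <= X)%N]capvC -capvA capvC.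
rewrite [(orthov _ <<s>> :&: U)%VS]capvC.
have := leq_dim_orthov1 form u (U :&: orthov form <<s>>); lia.
Qed.

Lemma leq_dim_cap_orthov U V :
  (\dim U <= \dim (U :&: orthov form V) + \dim V)%N.
Proof.
have := leq_dim_cap_orthov_span U (vbasis V).
by rewrite size_tuple (span_basis (vbasisP V)).
Qed.

Lemma orthonormal_catI s1 s2 :
  orthonormal form s1 -> orthonormal form s2 -> orthogonal form s1 s2 ->
  orthonormal form (s1 ++ s2).
Proof.
move=> /andP[n1 o1] /andP[n2 o2] o12; rewrite /orthonormal all_cat n1 n2 /=.
elim: s1 {n1} o1 o12 => //= u s1 IHs /andP[/andP[us1 _] /IHs{}IHs].
by case/andP=> us2 /IHs->; rewrite all_cat us1 us2.
Qed.

Hypothesis form_aniso : forall x, form x x = 0 -> x = 0.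

Lemma cap_orthov V : (V :&: orthov form V = 0)%VS.
Proof.
apply/eqP; rewrite -subv0; apply/subvP => x; rewrite memv_cap memv0.
by case/andP => xV /mem_orthovP/(_ x xV)/form_aniso->.
Qed.

(** Anisotropy makes the sum direct, so its dimension is the sum of the two, at least [\dim W] by
    the count above; an inclusion with enough dimension is an equality. *)
Lemma addv_orthov V W :
  (V <= W)%VS -> (V + (orthov form V :&: W) = W)%VS.
Proof.
move=> VW; apply/eqP; rewrite eqEdim subv_add VW capvSr /=.
rewrite dimv_disjoint_sum; last first.
  by apply/eqP; rewrite -subv0 -(cap_orthov V) capvA capvSl.
by rewrite addnC capvC leq_dim_cap_orthov.
Qed.

End HermitianForms.

Section Dot.
Context (R : realType) (K : RorC) (n : nat).
Local Notation F := (RCfield R K).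
Implicit Types (x : 'cV[F]_n) (U : {vspace 'cV[F]_n}).

Lemma dot_aniso x : dot x x = 0 -> x = 0.
Proof.
by move=> x0; apply/eqP; apply: contraT => /dot_pos; rewrite x0 ltxx.
Qed.

(** With [a] the squared norm of a vector, [c] is the factor that makes this vector a unit one: the
    inverse square root of [a], taken in each field separately. *)
Lemma RCconj_normalizer (a : F) : 0 < a -> exists c : F, c * RCconj c * a = 1.
Proof.
case: K a => /= a a_gt0.
  exists (Num.sqrt a)^-1.
  by rewrite -invfM -expr2 sqr_sqrtr ?ltW// mulVf ?gt_eqF.
(* The root of a positive [a] is nonnegative, hence fixed by conjugation. *)
exists (sqrtC a)^-1; rewrite geC0_conj ?invr_ge0 ?sqrtC_ge0 ?ltW//.
by rewrite -invfM -expr2 sqrtCK mulVf ?gt_eqF.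
Qed.

Lemma dot_normalize x :
  x != 0 -> exists y, dot y y = 1 /\ (<[y]> = <[x]>)%VS.
Proof.
move=> x_neq0; have [c cx] := RCconj_normalizer (dot_pos x_neq0).
exists (c *: x); split; first by rewrite linearZl_LR linearZr_LR /= mulrA.
have c_neq0 : c != 0.
  by apply: contra_eq_neq cx => ->; rewrite !mul0r eq_sym oner_neq0.
apply/eqP; rewrite eqEsubv -!memvE memvZ ?memv_line//=.
by apply/vlineP; exists c^-1; rewrite scalerA mulVf ?scale1r.
Qed.

(** Induction on the dimension: a unit vector [y] of [U] is split off, and the rest of the basis
    comes from the orthogonal of [y] in [U]. *)
Lemma orthonormal_basis U :
  exists s, [/\ orthonormal (@dot R K n) s, <<s>>%VS = U & size s = \dim U].
Proof.
have [d dimU] := ubnP (\dim U); elim: d => // d IHd in U dimU *.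
have [->|U_neq0] := eqVneq U 0%VS.
  by exists [::]; rewrite span_nil dimv0.
have Uu := memv_pick U; have u_neq0 : vpick U != 0 by rewrite vpick0.
have [y [y1 yE]] := dot_normalize u_neq0.
have yU : (<[y]> <= U)%VS by rewrite yE -memvE.
have y_neq0 : y != 0 by apply: contra_eq_neq y1 => ->; rewrite linear0r eq_sym oner_neq0.
have UE := addv_orthov dot_aniso yU.
set W := (orthov _ <[y]> :&: U)%VS in UE.
have dimUE : \dim U = (\dim W).+1.
  rewrite -UE dimv_disjoint_sum ?dim_vline ?y_neq0//.
  by apply/eqP; rewrite -subv0 -(cap_orthov dot_aniso <[y]>) capvA capvSl.
have [|s [s_on sW s_size]] := IHd W; first by rewrite dimUE in dimU.
exists (y :: s); rewrite span_cons sW UE /= s_size dimUE; split=> //.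
rewrite -cat1s; apply: orthonormal_catI => //.
  by rewrite /orthonormal /= y1 eqxx.
by rewrite orthogonalE span_seq1 sW orthov_sym capvSl.
Qed.

End Dot.

Lemma size_cols (F : fieldType) (m n : nat) (V : 'M[F]_(m, n)) : size (cols V) = n.
Proof. by rewrite size_map size_enum_ord. Qed.

Lemma nth_cols (F : fieldType) (m n : nat) (V : 'M[F]_(m, n)) (j : 'I_n) :
  (cols V)`_j = col j V.
Proof. by rewrite (nth_map j) ?size_enum_ord ?nth_ord_enum. Qed.

Lemma cols_row_mx (F : fieldType) (m n1 n2 : nat)
    (V1 : 'M[F]_(m, n1)) (V2 : 'M[F]_(m, n2)) :
  cols (row_mx V1 V2) = cols V1 ++ cols V2.
Proof.
apply: (@eq_from_nth _ 0) => [|i]; first by rewrite size_cat !size_cols.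
rewrite size_cols => i_lt; change i with (nat_of_ord (Ordinal i_lt)).
rewrite nth_cols nth_cat size_cols; case: splitP => j jE.
  have -> : Ordinal i_lt = lshift n2 j by apply: val_inj.
  by rewrite nth_cols colKl.
have -> : Ordinal i_lt = rshift n1 j by apply: val_inj.
by rewrite /= addKn nth_cols colKr.
Qed.

(** Turns the orthonormal lists obtained above into the matrices that the theorem asks for. *)
Lemma cols_surj (F : fieldType) (m n : nat) (s : seq 'cV[F]_m) :
  size s = n -> exists V : 'M[F]_(m, n), cols V = s.
Proof.
move=> s_size; exists (\matrix_(i, j) s`_j i 0).
apply: (@eq_from_nth _ 0) => [|i]; rewrite size_cols// => i_lt.
change i with (nat_of_ord (Ordinal i_lt)); rewrite nth_cols.
by apply/colP => k; rewrite !mxE.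
Qed.

Lemma dim_addv_mximg (F : fieldType) (n : nat) (A : 'M[F]_n)
    (S : {vspace 'cV[F]_n}) :
  \dim (S + mximg A S) = (\dim S + invariance_index A S)%N.
Proof. by rewrite subnKC// dimvS// addvSl. Qed.

Lemma invariance_index_bound (F : fieldType) (n : nat) (A : 'M[F]_n)
    (S : {vspace 'cV[F]_n}) :
  (invariance_index A S <= minn (\dim S) (n - \dim S))%N.
Proof.
have dim_full : (\dim (S + mximg A S) <= n)%N.
  by rewrite (leq_trans (dimvS (subvf _)))// dimvf /dim /= muln1.
(* Rank-nullity for [A] restricted to [S]. *)
have dim_img : (\dim (mximg A S) <= \dim S)%N.
  by rewrite -(limg_ker_dim (linfun (mulmx A)) S) leq_addl.
have := leq_of_leqif (dimv_add_leqif S (mximg A S)).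
have := dim_addv_mximg A S; lia.
Qed.

Theorem lemma2p10 (R : realType) (K : RorC) (n : nat) (n_ge1 : (1 <= n)%N)
    (A : 'M[RCfield R K]_n) (p q : nat) (S : {vspace 'cV[RCfield R K]_n})
    (dimS : \dim S = p) (indS : q = invariance_index A S) :
  (invariance_index A S <= minn (\dim S) (n - \dim S) <= n %/ 2)%N
  /\
  ((1 <= p)%N ->
   exists V : 'M[RCfield R K]_(n, p),
     [/\ semi_unitary V,
         colspace V = S
       & (1 <= q)%N ->
         exists V' : 'M[RCfield R K]_(n, q),
           [/\ semi_unitary (row_mx V V'),
               colspace (row_mx V V') = (S + mximg A S)%VS
             & colspace V' = (orthocompl S :&: (S + mximg A S))%VS]]).
Proof.
split; first by rewrite invariance_index_bound /=; lia.
move=> _; have [s [s_on sS s_size]] := orthonormal_basis S.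
have [V VE] := cols_surj (etrans s_size dimS).
exists V; rewrite /semi_unitary /colspace VE; split=> // _.
set T := (S + mximg A S)%VS; have ST : (S <= T)%VS by exact: addvSl.
have TE := addv_orthov (@dot_aniso R K n) ST.
have [s' [s'_on s'E s'_size]] := orthonormal_basis (orthocompl S :&: T).
have [|V' V'E] := @cols_surj _ _ q s'.
  (* Both sides are compared after adding [\dim S]: each total is [\dim T], by the definition of the
     index and by the direct splitting of [T]. *)
  apply/eqP; rewrite s'_size indS -(eqn_add2l (\dim S)) -dim_addv_mximg.
  rewrite -/T -{2}TE dimv_disjoint_sum//.
  by apply/eqP; rewrite -subv0 -(cap_orthov (@dot_aniso R K n) S) capvA capvSl.
exists V'; rewrite cols_row_mx VE V'E span_cat sS s'E; split=> //.
(* The two lists are mutually orthogonal since [s'] spans a subspace of the orthogonal of [S]. *)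
by apply: orthonormal_catI; rewrite // orthogonalE sS s'E orthov_sym capvSl.
Qed.
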